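(* Let $L$ be a complete and completely distributive lattice, $G$ a group, and let $\mu\in L(G)$ be a nilpotent $L$-group. Let $\eta$ be an $L$-subgroup of $\mu$ having the same tip and tail as $\mu$. Then $\eta$ is a normal $L$-subgroup of $\mu$ if and only if $\eta$ is a pronormal $L$-subgroup of $\mu$.
   Context: $L$ has least element $0$ and greatest element $1$; $e$ is the identity of $G$. An $L$-subset of $G$ is a function $G \to L$; inclusion $\eta\subseteq\mu$ means $\eta(x)\le\mu(x)$ for all $x\in G$; unions and intersections of $L$-subsets are pointwise joins and meets. The tip and tail of an $L$-subset $\mu$ are $\bigvee_{x\in G}\mu(x)$ and $\bigwedge_{x\in G}\mu(x)$; the tail is also written $\inf\mu$. An $L$-subgroup of $G$ is a function $\mu: G\to L$ with $\mu(xy)\ge\mu(x)\wedge\mu(y)$ and $\mu(x^{-1})=\mu(x)$ for all $x,y\in G$; $L(G)$ is the set of these. For $\mu\in L(G)$, $L(\mu)$ denotes the set of $\eta\in L(G)$ with $\eta\subseteq\mu$ (the $L$-subgroups of $\mu$). For an $L$-subset $\theta$ of $G$, $\langle\theta\rangle$ is the smallest $L$-subgroup of $G$ containing $\theta$, and $\langle\eta,\nu\rangle=\langle\eta\cup\nu\rangle$. $L$-points: for $a\in L$, $x\in G$, the $L$-point $a_x$ is the $L$-subset with value $a$ at $x$ and $0$ elsewhere; $a_x\in\mu$ means $\mu(x)\ge a$. Conjugate: for $\eta\in L(\mu)$ and $a_z\in\mu$, $\eta^{a_z}$ is the $L$-subgroup of $\mu$ given by $\eta^{a_z}(x)=a\wedge\eta(zxz^{-1})$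 for all $x\in G$. Pronormal: $\eta\in L(\mu)$ is a pronormal $L$-subgroup of $\mu$ if for every $L$-point $a_x\in\mu$ there exists an $L$-point $b_y\in\langle\eta,\eta^{a_x}\rangle$ such that $\eta^{b_y}=\eta^{a_x}$. Normal: $\eta\in L(\mu)$ is a normal $L$-subgroup of $\mu$ if $\eta(yxy^{-1})\ge\eta(x)\wedge\mu(y)$ for all $x,y\in G$. Commutators: for $L$-subsets $\eta,\theta$ of $G$ contained in $\mu$, $(\eta,\theta)$ is the $L$-subset with $(\eta,\theta)(x)=\bigvee\{\eta(y)\wedge\theta(z) : y,z\in G,\ x=[y,z]\}$ if $x$ is a commutator $[y,z]$ of some $y,z\in G$, and $(\eta,\theta)(x)=\inf\eta\wedge\inf\theta$ otherwise. Put $[\eta,\theta]=\langle(\eta,\theta)\rangle$. Nilpotent: for $\mu\in L(G)$ put $Z_0(\mu)=\mu$ and $Z_{i+1}(\mu)=[Z_i(\mu),\mu]$ for $i\ge0$. Let $a_0$ and $t_0$ be the tip and tail of $\mu$. $\mu$ is nilpotent if $a_0\ne t_0$ and there is a non-negative integer $c$ such that $Z_c(\mu)$ is the trivial $L$-subgroup $\mu_{t_0}^{a_0}$, defined by $\mu_{t_0}^{a_0}(e)=a_0$ and $\mu_{t_0}^{a_0}(x)=t_0$ for $x\ne e$. *)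

(* Defs.v *)
From mathcomp Require Import all_boot all_order.
From mathcomp Require Import boolp classical_sets.

Set Implicit Arguments.
Unset Strict Implicit.
Unset Printing Implicit Defensive.

Import Order.Theory.

Local Open Scope classical_set_scope.
Local Open Scope group_scope.
Local Open Scope order_scope.

Definition complete_lattice d (L : tbLatticeType d) : Prop :=
  forall A : set L, supremums A !=set0 /\ infimums A !=set0.

(* [supremum] and [infimum] return their first argument on the empty set, so
   these are the correct joins and meets of arbitrary, possibly empty, sets as
   soon as L is complete. *)
Definition bigjoin d (L : tbLatticeType d) (A : set L) : L := supremum \bot A.
Definition bigmeet d (L : tbLatticeType d) (A : set L) : L := infimum \top A.

Definition completely_distributive d (L : tbLatticeType d) : Prop :=
  forall (I : Type) (J : I -> Type) (x : forall i, J i -> L),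
    bigmeet (range (fun i => bigjoin (range (x i)))) =
    bigjoin (range (fun f : forall i, J i =>
      bigmeet (range (fun i => x i (f i))))).

Definition Lincl d (L : tbLatticeType d) (G : groupType)
    (eta mu : G -> L) : Prop :=
  forall x, eta x <= mu x.

Definition Lunion d (L : tbLatticeType d) (G : groupType)
    (eta nu : G -> L) : G -> L :=
  fun x => eta x `|` nu x.

Definition tip d (L : tbLatticeType d) (G : groupType) (mu : G -> L) : L :=
  bigjoin (range mu).
Definition tail d (L : tbLatticeType d) (G : groupType) (mu : G -> L) : L :=
  bigmeet (range mu).

Definition Lsubgroup d (L : tbLatticeType d) (G : groupType)
    (mu : G -> L) : Prop :=
  (forall x y : G, mu x `&` mu y <= mu (x * y)%g) /\
  (forall x : G, mu x^-1%g = mu x).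

Definition Lsubgroup_of d (L : tbLatticeType d) (G : groupType)
    (mu eta : G -> L) : Prop :=
  Lsubgroup eta /\ Lincl eta mu.

(* The intersection of all L-subgroups containing theta; see [Lgen_smallest]. *)
Definition Lgen d (L : tbLatticeType d) (G : groupType)
    (theta : G -> L) : G -> L :=
  fun x => bigmeet [set nu x | nu in [set nu : G -> L |
                                       Lsubgroup nu /\ Lincl theta nu]].

Definition Lgen2 d (L : tbLatticeType d) (G : groupType)
    (eta nu : G -> L) : G -> L :=
  Lgen (Lunion eta nu).

(* An L-point a_x is represented by its height a and its support x. *)
Definition Lpoint_in d (L : tbLatticeType d) (G : groupType)
    (a : L) (x : G) (mu : G -> L) : Prop :=
  a <= mu x.

(* The library's conjugate x ^ z is z^-1 * x * z, hence the explicit product. *)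
Definition Lconj d (L : tbLatticeType d) (G : groupType)
    (eta : G -> L) (a : L) (z : G) : G -> L :=
  fun x => a `&` eta (z * x * z^-1)%g.

Definition pronormal d (L : tbLatticeType d) (G : groupType)
    (mu eta : G -> L) : Prop :=
  forall (a : L) (x : G), Lpoint_in a x mu ->
    exists (b : L) (y : G),
      Lpoint_in b y (Lgen2 eta (Lconj eta a x)) /\
      Lconj eta b y = Lconj eta a x.

Definition Lnormal d (L : tbLatticeType d) (G : groupType)
    (mu eta : G -> L) : Prop :=
  forall x y : G, eta x `&` mu y <= eta (y * x * y^-1)%g.

(* [~ y, z] is y^-1 * z^-1 * y * z.  As L-subgroups are invariant under
   inversion, the other usual convention y * z * y^-1 * z^-1 gives the same
   L-subset whenever eta and theta are L-subgroups. *)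
Definition Lcommutator_set d (L : tbLatticeType d) (G : groupType)
    (eta theta : G -> L) : G -> L :=
  fun x =>
    if `[< exists y z : G, x = [~ y, z]%g >] then
      bigjoin [set l : L | exists y z : G,
                             x = [~ y, z]%g /\ l = eta y `&` theta z]
    else tail eta `&` tail theta.

Definition Lcommutator d (L : tbLatticeType d) (G : groupType)
    (eta theta : G -> L) : G -> L :=
  Lgen (Lcommutator_set eta theta).

Fixpoint Lcentral d (L : tbLatticeType d) (G : groupType)
    (mu : G -> L) (i : nat) : G -> L :=
  if i is j.+1 then Lcommutator (Lcentral mu j) mu else mu.

Definition Ltrivial d (L : tbLatticeType d) (G : groupType)
    (a t : L) : G -> L :=
  fun x => if x == 1%g then a else t.

Definition Lnilpotent d (L : tbLatticeType d) (G : groupType)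
    (mu : G -> L) : Prop :=
  tip mu <> tail mu /\
  exists c : nat, Lcentral mu c = Ltrivial (tip mu) (tail mu).

Lemma bigmeet_lb d (L : tbLatticeType d) (A : set L) (l : L) :
  complete_lattice L -> A l -> bigmeet A <= l.
Proof.
move=> cL Al; rewrite /bigmeet /infimum; case: eqP => [A0|_].
  by move: Al; rewrite A0.
by case: xgetP => [m _ [+ _]|none]; [apply|case: (cL A) => _ [m /none]].
Qed.

Lemma bigmeet_glb d (L : tbLatticeType d) (A : set L) (l : L) :
  complete_lattice L -> (forall m, A m -> l <= m) -> l <= bigmeet A.
Proof.
move=> cL lA; rewrite /bigmeet /infimum; case: ifP => _; first exact: lex1.
by case: xgetP => [m _ [_]|none]; [apply|case: (cL A) => _ [m /none]].
Qed.

Lemma Lgen_smallest d (L : tbLatticeType d) (G : groupType) (theta : G -> L) :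
  complete_lattice L ->
  [/\ Lsubgroup (Lgen theta), Lincl theta (Lgen theta) &
      forall nu : G -> L, Lsubgroup nu -> Lincl theta nu ->
        Lincl (Lgen theta) nu].
Proof.
move=> cL.
have le_gen (nu : G -> L) x :
    Lsubgroup nu -> Lincl theta nu -> Lgen theta x <= nu x.
  by move=> sn tn; apply: bigmeet_lb => //; exists nu.
have Vle x : Lgen theta x <= Lgen theta x^-1%g.
  apply: bigmeet_glb => // _ [nu [sn tn] <-].
  by rewrite (proj2 sn) le_gen.
split.
- split=> [x y|x].
    apply: bigmeet_glb => // _ [nu [sn tn] <-].
    by apply: le_trans (proj1 sn x y); rewrite leI2 // le_gen.
  by apply/eqP; rewrite eq_le Vle andbT -{2}[x]invgK Vle.
- by move=> x; apply: bigmeet_glb => // _ [nu [_ tn] <-].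
- by move=> nu sn tn x; apply: le_gen.
Qed.

(* Main.v *)
(** Pronormal implies normal: by descending induction along the central series,
    every [Z_i] lies in the normalizer [N] of [eta].  If [Z_(i+1)] does and
    [a <= Z_i x], then [g = h * [~ h, x]] with [h = x * g * x^-1] shows that
    [eta^(a_x)] lies in [N], hence so does the point [b_y] given by
    pronormality.  Thus [b] meets [eta] in [eta^(a_x)]; comparing values at the
    identity gives [a = b], so [a_x] normalizes [eta]. *)

Require Import Defs.
From mathcomp Require Import all_boot all_order.
From mathcomp Require Import boolp classical_sets.

Set Implicit Arguments.
Unset Strict Implicit.
Unset Printing Implicit Defensive.

Import Order.Theory.

Local Open Scope classical_set_scope.
Local Open Scope group_scope.
Local Open Scope order_scope.

Lemma bigjoin_ub d (L : tbLatticeType d) (A : set L) (l : L) :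
  complete_lattice L -> A l -> l <= bigjoin A.
Proof.
move=> cL Al; rewrite /bigjoin /supremum; case: eqP => [A0|_].
  by move: Al; rewrite A0.
by case: xgetP => [m _ [+ _]|none]; [apply|case: (cL A) => [[m /none]]].
Qed.

Lemma bigjoin_lub d (L : tbLatticeType d) (A : set L) (l : L) :
  complete_lattice L -> (forall m, A m -> m <= l) -> bigjoin A <= l.
Proof.
move=> cL Al; rewrite /bigjoin /supremum; case: ifP => _; first exact: le0x.
by case: xgetP => [m _ [_]|none]; [apply|case: (cL A) => [[m /none]]].
Qed.

(** Frame law in inequality form: complete distributivity is applied to two families, [S] and the
    singleton of [a]; each choice function then selects a single [s] in [S] together with [a]. *)
Lemma meet_bigjoin_le d (L : tbLatticeType d) (a m : L) (S : set L) :
  complete_lattice L -> completely_distributive L ->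
  (forall s, S s -> a `&` s <= m) -> a `&` bigjoin S <= m.
Proof.
move=> cL cdL Sm.
pose A (i : bool) : set L := if i then S else [set a].
have := cdL bool (fun i => {l : L | A i l}) (fun i => sval).
set lhs := bigmeet _; set rhs := bigjoin _ => lr.
apply: (@le_trans _ _ lhs).
  apply: bigmeet_glb => // _ [[] _ <-].
    apply: leIxr; apply: bigjoin_lub => // s Ss.
    by apply: bigjoin_ub => //; exists (exist (A true) s Ss).
  apply: leIxl; apply: bigjoin_ub => //.
  by exists (exist (A false) a erefl).
rewrite lr; apply: bigjoin_lub => // _ [f _ <-].
apply: le_trans (Sm _ (svalP (f true))).
rewrite lexI; apply/andP; split; apply: bigmeet_lb => //.
  by exists false => //; exact: (svalP (f false)).
Qed.

Section LSubgroups.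
Context d (L : tbLatticeType d) (G : groupType).
Hypothesis cL : complete_lattice L.
Implicit Types (mu eta theta : G -> L) (a c : L) (x y z g : G).

Lemma Lsubgroup_le1 mu x : Lsubgroup mu -> mu x <= mu 1%g.
Proof. by case=> muM muV; have := muM x x^-1%g; rewrite muV mulgV meetxx. Qed.

Lemma tip_Lsubgroup mu : Lsubgroup mu -> tip mu = mu 1%g.
Proof.
move=> smu; apply/eqP; rewrite eq_le; apply/andP; split.
  by apply: bigjoin_lub => // _ [x _ <-]; apply: Lsubgroup_le1.
by apply: bigjoin_ub => //; exists 1%g.
Qed.

Lemma tail_le mu x : tail mu <= mu x.
Proof. by apply: bigmeet_lb => //; exists x. Qed.

Lemma Lsubgroup_Lcommutator eta theta : Lsubgroup (Lcommutator eta theta).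
Proof. by case: (Lgen_smallest (Lcommutator_set eta theta) cL). Qed.

Lemma Lcommutator_ge eta theta y z :
  eta y `&` theta z <= Lcommutator eta theta [~ y, z]%g.
Proof.
have [_ sub _] := Lgen_smallest (Lcommutator_set eta theta) cL.
apply: le_trans (sub _); rewrite /Lcommutator_set.
case: asboolP => [_|[]]; last by exists y, z.
by apply: bigjoin_ub => //; exists y, z.
Qed.

Lemma Lcommutator_sub mu eta : Lsubgroup mu -> Lincl eta mu ->
  Lincl (Lcommutator eta mu) mu.
Proof.
move=> smu sub; have [muM muV] := smu.
have [_ _ least] := Lgen_smallest (Lcommutator_set eta mu) cL.
apply: least => // x; rewrite /Lcommutator_set; case: asboolP => _.
  apply: bigjoin_lub => // _ [y [z [-> ->]]].
  apply: (@le_trans _ _ (mu y `&` mu z)); first by rewrite leI2.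
  rewrite commgEl conjgE.
  apply: le_trans (muM _ _); rewrite lexI muV leIl /=.
  apply: le_trans (muM _ _); rewrite lexI muV leIr /=.
  exact: muM.
by apply: leIxr; apply: tail_le.
Qed.

Lemma Lsubgroup_Lcentral mu i : Lsubgroup mu -> Lsubgroup (Lcentral mu i).
Proof. by case: i => //= i _; apply: Lsubgroup_Lcommutator. Qed.

Lemma Lcentral_sub mu i : Lsubgroup mu -> Lincl (Lcentral mu i) mu.
Proof.
by move=> smu; elim: i => [x|i IH] //=; apply: Lcommutator_sub.
Qed.

(** The condition is one-sided, bounding conjugation by [y] only; an actual normalizer asks for it
    at [y^-1] as well. *)
Definition normalizes eta c y : Prop :=
  forall g, c `&` eta g <= eta (y * g * y^-1)%g.

(* Capped by [eta 1], since otherwise the value at the identity would be the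
   top of L, which may exceed the tip. *)
Definition Lnormalizer eta y : L :=
  bigjoin [set c | [/\ c <= eta 1%g, normalizes eta c y
                     & normalizes eta c y^-1%g]].

Lemma Lnormalizer_ge eta c y : c <= eta 1%g ->
  normalizes eta c y -> normalizes eta c y^-1%g -> c <= Lnormalizer eta y.
Proof. by move=> *; apply: bigjoin_ub. Qed.

Lemma Lnormalizer_le1 eta y : Lnormalizer eta y <= eta 1%g.
Proof. by apply: bigjoin_lub => // c []. Qed.

Lemma LnormalizerV eta y : Lnormalizer eta y^-1%g = Lnormalizer eta y.
Proof.
by congr bigjoin; apply/seteqP; split=> c /=; rewrite invgK => -[].
Qed.

Lemma normalizesM eta c y z :
  normalizes eta c y -> normalizes eta c z -> normalizes eta c (y * z)%g.
Proof.
move=> ny nz g.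
have -> : (y * z * g * (y * z)^-1 = y * (z * g * z^-1) * y^-1)%g.
  by rewrite invgM !mulgA.
by apply: le_trans (ny _); rewrite lexI leIl nz.
Qed.

Lemma normalizes_le eta c c' y :
  c' <= c -> normalizes eta c y -> normalizes eta c' y.
Proof. by move=> le_c ny g; apply: le_trans (ny g); rewrite leI2. Qed.

(** The inverse supplies the reverse inequality, so after truncation at [c] conjugation by [y]
    leaves [eta] unchanged. *)
Lemma normalizes_meet eta c y g : normalizes eta c y ->
  normalizes eta c y^-1%g -> c `&` eta (y * g * y^-1)%g = c `&` eta g.
Proof.
move=> ny nyV; apply/eqP; rewrite eq_le !lexI !leIl ny /= andbT.
by have := nyV (y * g * y^-1)%g; rewrite invgK !mulgA mulVg mul1g mulgVK.
Qed.

Lemma Lnormalizer_sub eta : Lsubgroup eta -> Lincl eta (Lnormalizer eta).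
Proof.
move=> seta y; have [etaM etaV] := seta.
have norm z : normalizes eta (eta z) z.
  move=> g; apply: le_trans (etaM _ _); rewrite lexI etaV leIl andbT.
  exact: etaM.
apply: Lnormalizer_ge => //; first exact: Lsubgroup_le1.
by rewrite -(etaV y).
Qed.

Lemma Lnormal_normalizes mu eta y :
  Lnormal mu eta -> normalizes eta (mu y) y.
Proof. by move=> nrm g; rewrite meetC nrm. Qed.

(** Normality makes conjugation by [a_x] a mere truncation at [a], which conjugation by [a_1]
    achieves too; the point [a_1] lies in [eta] because [a <= mu x <= mu 1 = eta 1]. *)
Lemma normal_pronormal mu eta : Lsubgroup mu -> Lsubgroup eta ->
  eta 1%g = mu 1%g -> Lnormal mu eta -> pronormal mu eta.
Proof.
move=> smu seta eta1 nrm a x ax; exists a, 1%g; split.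
  have [_ sub _] := Lgen_smallest (Lunion eta (Lconj eta a x)) cL.
  apply: le_trans (sub _); apply: lexUl; rewrite eta1.
  by rewrite (le_trans ax) // Lsubgroup_le1.
apply/funext => g; rewrite /Lconj mul1g invg1 mulg1.
have nx z : a <= mu z -> normalizes eta a z.
  by move=> az; apply: normalizes_le az _; apply: Lnormal_normalizes.
by rewrite normalizes_meet //; apply: nx; rewrite // (proj2 smu).
Qed.

Hypothesis cdL : completely_distributive L.

(** Distributing the meet over the join shows that the supremum defining the normalizer is itself a
    normalizing height. *)
Lemma normalizes_Lnormalizer eta y : normalizes eta (Lnormalizer eta y) y.
Proof.
by move=> g; rewrite meetC; apply: meet_bigjoin_le => // c [_ ny _]; rewrite meetC.
Qed.

Lemma Lsubgroup_Lnormalizer eta : Lsubgroup (Lnormalizer eta).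
Proof.
split=> [x y|x]; last exact: LnormalizerV.
have n z c : c <= Lnormalizer eta z -> normalizes eta c z.
  by move=> le_c; apply: normalizes_le le_c _; apply: normalizes_Lnormalizer.
apply: Lnormalizer_ge; first by rewrite leIxl // Lnormalizer_le1.
  by apply: normalizesM; apply: n; rewrite ?leIl ?leIr.
by rewrite invgM; apply: normalizesM; apply: n; rewrite LnormalizerV ?leIl ?leIr.
Qed.

Lemma pronormal_in_Lnormalizer mu eta a x :
    Lsubgroup eta -> eta 1%g = mu 1%g -> Lsubgroup mu -> pronormal mu eta ->
    a <= mu x -> Lincl (Lconj eta a x) (Lnormalizer eta) ->
  a <= Lnormalizer eta x.
Proof.
move=> seta eta1 smu pro ax sub.
have [b [y [by_in conj_eq]]] := pro a x ax.
have [_ _ least] := Lgen_smallest (Lunion eta (Lconj eta a x)) cL.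
(* Both generators lie in the normalizer, which is an L-subgroup, so it contains all they generate,
   in particular [b_y]. *)
have by_N : b <= Lnormalizer eta y.
  apply: le_trans by_in _; apply: least; first exact: Lsubgroup_Lnormalizer.
  by move=> g; rewrite /Lunion leUx sub Lnormalizer_sub.
have a1 : a <= eta 1%g by rewrite eta1 (le_trans ax) // Lsubgroup_le1.
have b1 : b <= eta 1%g by rewrite (le_trans by_N) // Lnormalizer_le1.
(* As [b_y] normalizes [eta], the conjugate by [b_y] is just [eta] truncated at [b]. *)
have conjE g : b `&` eta g = a `&` eta (x * g * x^-1)%g.
  rewrite -[RHS]/(Lconj eta a x g) -conj_eq /Lconj normalizes_meet //.
    by apply: normalizes_le by_N _; apply: normalizes_Lnormalizer.
  apply: normalizes_le by_N _; rewrite -LnormalizerV.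
  exact: normalizes_Lnormalizer.
have ab : b = a.
  have := conjE 1%g; rewrite mulg1 mulgV.
  by rewrite (meet_idPl a1) (meet_idPl b1).
apply: Lnormalizer_ge => // g; first by rewrite -{1}ab conjE leIr.
(* This substitution turns [conjE] into the condition for [x^-1]. *)
have := conjE (x^-1 * g * x)%g.
by rewrite !mulgA mulgV mul1g mulgK invgK ab => <-; rewrite leIr.
Qed.

Lemma Lcentral_sub_Lnormalizer mu eta i :
    Lsubgroup mu -> Lsubgroup_of mu eta -> eta 1%g = mu 1%g ->
    pronormal mu eta -> Lincl (Lcentral mu i.+1) (Lnormalizer eta) ->
  Lincl (Lcentral mu i) (Lnormalizer eta).
Proof.
move=> smu [seta sub] eta1 pro subN x.
apply: (pronormal_in_Lnormalizer (mu := mu)) => //; first exact: Lcentral_sub.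
move=> g; rewrite /Lconj; set h := (x * g * x^-1)%g.
have -> : g = (h * [~ h, x])%g.
  by rewrite commgEl mulVKg conjgE /h !mulgA mulVg mul1g mulgVK.
apply: le_trans (proj1 (Lsubgroup_Lnormalizer eta) _ _).
(* The factor [h] is covered by [eta h]. The factor [[~ h, x]] is inverted to [[~ x, h]] because the
   central series has [Z_i] in the first slot; there [Z_i x] serves for [x], and [eta h <= mu h] for
   the second slot. *)
rewrite lexI leIxr ?Lnormalizer_sub //= -LnormalizerV invgR.
apply: le_trans (subN _).
by apply: le_trans (Lcommutator_ge _ _ _ _); rewrite leI2.
Qed.

Lemma pronormal_normal mu eta : Lsubgroup mu -> Lnilpotent mu ->
  Lsubgroup_of mu eta -> eta 1%g = mu 1%g -> tail eta = tail mu ->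
  pronormal mu eta -> Lnormal mu eta.
Proof.
move=> smu [_ [c Zc]] etamu eta1 tl pro; have [seta _] := etamu.
suff muN : Lincl (Lcentral mu 0) (Lnormalizer eta).
  move=> x y; rewrite meetC.
  by apply: normalizes_le (muN y) _ _; apply: normalizes_Lnormalizer.
(* Start of the descent: equal tips handle the identity and equal tails all other points, so the
   trivial L-subgroup [Z_c] lies in [eta], hence in its normalizer. *)
have : Lincl (Lcentral mu c) (Lnormalizer eta).
  move=> x; apply: le_trans (Lnormalizer_sub seta x).
  rewrite Zc /Ltrivial; case: eqP => [->|_].
    by rewrite tip_Lsubgroup // eta1.
  by rewrite -tl tail_le.
elim: c {Zc} => // c IH subN.
by apply: IH; apply: (Lcentral_sub_Lnormalizer (mu := mu)).
Qed.

End LSubgroups.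

Theorem corollary4p22 (d : Order.disp_t) (L : tbLatticeType d)
    (G : groupType) (mu eta : G -> L) :
  complete_lattice L -> completely_distributive L ->
  Lsubgroup mu -> Lnilpotent mu ->
  Lsubgroup_of mu eta -> tip eta = tip mu -> tail eta = tail mu ->
  (Lnormal mu eta <-> pronormal mu eta).
Proof.
move=> cL cdL smu nil etamu tp tl; have [seta _] := etamu.
have eta1 : eta 1%g = mu 1%g by rewrite -!tip_Lsubgroup.
by split; [apply: normal_pronormal | apply: pronormal_normal].
Qed.
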